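(* Let $k$, $\ell$, $n$, and $r$ be non-negative integers with $k\neq 0$, and let $\Delta_k=2\sqrt{1+k}$. Then the $k$-Pell-Lucas number $Q_{k,\ell n+r}$ can be represented by the integral $$Q_{k,\ell n+r}=\frac{1}{2^{n+1}}\int_{-1}^{1}\left(n\Delta_k^2P_{k,\ell} P_{k,r}+Q_{k,\ell}Q_{k,r}+(n+1)\Delta_k P_{k,\ell} Q_{k,r}\, x\right)\left(Q_{k,\ell}+\Delta_k P_{k,\ell}\, x\right)^{n-1}dx.$$
   Context: For a positive integer $k$, the $k$-Pell numbers $P_{k,n}$ ($n\ge 0$) are defined by $P_{k,0}=0$, $P_{k,1}=1$ and $P_{k,n}=2P_{k,n-1}+kP_{k,n-2}$ for $n\ge 2$. The $k$-Pell-Lucas numbers $Q_{k,n}$ ($n\ge 0$) are defined by $Q_{k,0}=2$, $Q_{k,1}=2$ and $Q_{k,n}=2Q_{k,n-1}+kQ_{k,n-2}$ for $n\ge 2$. *)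

(* Defs.v *)
From Stdlib Require Import Reals.
From Coquelicot Require Import Coquelicot.

Fixpoint kPell (k n : nat) : nat :=
  match n with
  | 0 => 0
  | S m => match m with
           | 0 => 1
           | S p => 2 * kPell k m + k * kPell k p
           end
  end.

Fixpoint kPellLucas (k n : nat) : nat :=
  match n with
  | 0 => 2
  | S m => match m with
           | 0 => 2
           | S p => 2 * kPellLucas k m + k * kPellLucas k p
           end
  end.

Definition Delta (k : nat) : R := (2 * sqrt (1 + INR k))%R.

(* The exponent [n - 1] is an integer, equal to -1 when [n = 0].  In that case
   the base may vanish at one point of [-1, 1] (when [l] is odd); the first
   factor vanishes there too, so [powerRZ] gives the integrand the harmless
   value 0 at that removable singularity. *)
Definition integrand (k l n r : nat) (x : R) : R :=
  let P i := INR (kPell k i) in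
  let Q i := INR (kPellLucas k i) in
  ((INR n * Delta k ^ 2 * P l * P r + Q l * Q r
      + (INR n + 1) * Delta k * P l * Q r * x)
   * powerRZ (Q l + Delta k * P l * x) (Z.of_nat n - 1))%R.

(* Main.v *)
Require Import Defs.
From Stdlib Require Import Reals Lra Lia.
From Coquelicot Require Import Coquelicot.

(** Write [a = Q_l], [b = Delta P_l], [c = Q_r], [d = Delta P_r].  For [n >= 1]
    the integrand is the derivative of [(d + c x) (a + b x)^n], so its integral
    over [[-1, 1]] is [(c + d) (a + b)^n + (c - d) (a - b)^n].  The Binet formula
    in the form [Q_i + 2 t P_i = 2 (1 + t)^i], valid for both square roots [t]
    of [1 + k], evaluates the four factors: with [s = sqrt (1 + k)] the integral
    is [2^(n+1) ((1 + s)^(l n + r) + (1 - s)^(l n + r))], and the sum of the two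
    powers is [Q_(l n + r)], again by the Binet formula.

    For [n = 0] the integrand is [c (a + b x) / (a + b x)], which is [c] except
    at the possible zero of [a + b x]; there is at most one zero because
    [a > 0], and one point does not affect the integral. *)

Lemma kPell_rec (k n : nat) :
  kPell k (S (S n)) = (2 * kPell k (S n) + k * kPell k n)%nat.
Proof. reflexivity. Qed.

Lemma kPellLucas_rec (k n : nat) :
  kPellLucas k (S (S n)) = (2 * kPellLucas k (S n) + k * kPellLucas k n)%nat.
Proof. reflexivity. Qed.

Lemma kPellLucas_pos (k n : nat) : (0 < kPellLucas k n)%nat.
Proof.
  enough (0 < kPellLucas k n /\ 0 < kPellLucas k (S n))%nat by tauto.
  induction n as [|n [IH1 IH2]]; [simpl; lia|].
  rewrite kPellLucas_rec; lia.
Qed.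

Local Open Scope R_scope.

(** Both sides satisfy the same second-order recurrence, because [1 + t] is a
    root of [X^2 = 2 X + k].  Leaving the sign of [t] open covers both roots of
    the characteristic equation at once. *)
Lemma kPellLucas_kPell_binet (k n : nat) (t : R) :
  t ^ 2 = 1 + INR k ->
  INR (kPellLucas k n) + 2 * t * INR (kPell k n) = 2 * (1 + t) ^ n.
Proof.
  intros Ht.
  set (B := fun i => INR (kPellLucas k i) + 2 * t * INR (kPell k i)
                     = 2 * (1 + t) ^ i).
  enough (B n /\ B (S n)) by tauto.
  unfold B; induction n as [|n [IH1 IH2]]; [simpl; lra|].
  split; [exact IH2|].
  rewrite kPellLucas_rec, kPell_rec, !plus_INR, !mult_INR.
  replace (INR 2) with 2 by reflexivity.
  transitivity (2 * (2 * (1 + t) ^ S n) + INR k * (2 * (1 + t) ^ n)).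
  - rewrite <- IH1, <- IH2; ring.
  - replace (INR k) with (t ^ 2 - 1) by lra; simpl; ring.
Qed.

Lemma pow2_sqrt_1_plus_INR (k : nat) : sqrt (1 + INR k) ^ 2 = 1 + INR k.
Proof. apply pow2_sqrt; pose proof (pos_INR k); lra. Qed.

Lemma kPellLucas_plus_Delta_kPell (k n : nat) :
  INR (kPellLucas k n) + Defs.Delta k * INR (kPell k n)
  = 2 * (1 + sqrt (1 + INR k)) ^ n.
Proof. apply kPellLucas_kPell_binet, pow2_sqrt_1_plus_INR. Qed.

Lemma kPellLucas_minus_Delta_kPell (k n : nat) :
  INR (kPellLucas k n) - Defs.Delta k * INR (kPell k n)
  = 2 * (1 - sqrt (1 + INR k)) ^ n.
Proof.
  assert (Hs : (- sqrt (1 + INR k)) ^ 2 = 1 + INR k)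
    by (rewrite <- Rsqr_pow2, <- Rsqr_neg, Rsqr_pow2; apply pow2_sqrt_1_plus_INR).
  pose proof (kPellLucas_kPell_binet k n _ Hs) as H.
  unfold Defs.Delta, Rminus; rewrite <- H; ring.
Qed.

Lemma kPellLucas_binet (k n : nat) :
  INR (kPellLucas k n)
  = (1 + sqrt (1 + INR k)) ^ n + (1 - sqrt (1 + INR k)) ^ n.
Proof.
  pose proof (kPellLucas_plus_Delta_kPell k n).
  pose proof (kPellLucas_minus_Delta_kPell k n).
  lra.
Qed.

(** [is_RInt_ext] ignores the end points of an interval, so an exceptional
    interior point is handled by splitting the interval there. *)
Lemma is_RInt_const_except_point (f : R -> R) (u v c x0 : R) :
  u <= v ->
  (forall x, u < x < v -> x <> x0 -> f x = c) ->
  is_RInt f u v ((v - u) * c).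
Proof.
  intros Huv Hf.
  assert (Hpiece : forall p q, u <= p <= q -> q <= v -> ~ p < x0 < q ->
                   is_RInt f p q ((q - p) * c)).
  { intros p q Hp Hq Hx0.
    apply (is_RInt_ext (fun _ => c)).
    - intros x Hx; rewrite Rmin_left, Rmax_right in Hx by lra.
      symmetry; apply Hf; lra.
    - exact (is_RInt_const p q c). }
  destruct (Rlt_dec u x0) as [H1|H1]; [destruct (Rlt_dec x0 v) as [H2|H2]|];
    try (apply Hpiece; lra).
  replace ((v - u) * c) with (plus ((x0 - u) * c) ((v - x0) * c))
    by (unfold plus; simpl; ring).
  apply (is_RInt_Chasles f u x0 v); apply Hpiece; lra.
Qed.

(** The integrand is the derivative of [(d + c x) (a + b x)^(m + 1)]; allowing
    [b = 0] covers the case [P_l = 0] without a separate argument. *)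
Lemma is_RInt_affine_mul_affine_pow (a b c d u v : R) (m : nat) :
  is_RInt
    (fun x => (INR (S m) * b * d + a * c + (INR (S m) + 1) * b * c * x)
              * (a + b * x) ^ m)
    u v ((d + c * v) * (a + b * v) ^ S m - (d + c * u) * (a + b * u) ^ S m).
Proof.
  apply (is_RInt_derive (fun x => (d + c * x) * (a + b * x) ^ S m)).
  - intros x _; auto_derive; [exact I|].
    (* The derivative is returned with [INR (S m)] unfolded. *)
    change (match m with 0%nat => 1 | S _ => INR m + 1 end) with (INR (S m)).
    ring.
  - intros x _; apply (ex_derive_continuous (V := R_NormedModule)).
    auto_derive; exact I.
Qed.

(** The two factors of the integrand cancel, leaving the constant [Q_r] away
    from the zero of [Q_l + Delta P_l x]. *)
Lemma is_RInt_integrand_0 (k l r : nat) :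
  is_RInt (integrand k l 0 r) (-1) 1 (2 * INR (kPellLucas k r)).
Proof.
  set (a := INR (kPellLucas k l)).
  set (b := Defs.Delta k * INR (kPell k l)).
  assert (Ha : 0 < a) by (apply lt_0_INR, kPellLucas_pos).
  replace 2 with (1 - -1) by ring.
  (* When [b = 0] the chosen point is [0], and [a + b x] has no zero at all. *)
  apply (is_RInt_const_except_point _ _ _ _ (- a / b)); [lra|].
  intros x _ Hx.
  assert (Hu : a + b * x <> 0).
  { intros H; apply Hx.
    assert (b <> 0) by (intros Hb; rewrite Hb in H; lra).
    replace (- a) with (b * x) by lra; field; assumption. }
  unfold integrand; fold a b; simpl powerRZ; simpl INR.
  fold b; rewrite ?Rmult_1_r.
  unfold b in *; field; assumption.
Qed.

Lemma integrand_S (k l m r : nat) (x : R) :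
  let P i := INR (kPell k i) in
  let Q i := INR (kPellLucas k i) in
  integrand k l (S m) r x
  = (INR (S m) * (Defs.Delta k * P l) * (Defs.Delta k * P r) + Q l * Q r
       + (INR (S m) + 1) * (Defs.Delta k * P l) * Q r * x)
    * (Q l + Defs.Delta k * P l * x) ^ m.
Proof.
  intros P Q; unfold integrand; fold (P l) (P r) (Q l) (Q r).
  replace (Z.of_nat (S m) - 1)%Z with (Z.of_nat m) by lia.
  rewrite <- pow_powerRZ; ring.
Qed.

Lemma is_RInt_integrand_S (k l m r : nat) :
  let P i := INR (kPell k i) in
  let Q i := INR (kPellLucas k i) in
  is_RInt (integrand k l (S m) r) (-1) 1
    ((Q r + Defs.Delta k * P r) * (Q l + Defs.Delta k * P l) ^ S m
     + (Q r - Defs.Delta k * P r) * (Q l - Defs.Delta k * P l) ^ S m).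
Proof.
  intros P Q.
  pose proof (is_RInt_affine_mul_affine_pow
                (Q l) (Defs.Delta k * P l) (Q r) (Defs.Delta k * P r) (-1) 1 m) as H.
  replace (_ + _) with
    ((Defs.Delta k * P r + Q r * 1) * (Q l + Defs.Delta k * P l * 1) ^ S m
     - (Defs.Delta k * P r + Q r * -1) * (Q l + Defs.Delta k * P l * -1) ^ S m).
  - eapply is_RInt_ext; [|exact H].
    intros x _; symmetry; apply integrand_S.
  - replace (Q l + Defs.Delta k * P l * 1) with (Q l + Defs.Delta k * P l) by ring.
    replace (Q l + Defs.Delta k * P l * -1) with (Q l - Defs.Delta k * P l) by ring.
    ring.
Qed.

Lemma is_RInt_integrand (k l n r : nat) :
  is_RInt (integrand k l n r) (-1) 1
    (2 ^ (n + 1) * INR (kPellLucas k (l * n + r))).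
Proof.
  destruct n as [|m].
  - replace (l * 0 + r)%nat with r by lia.
    replace (2 ^ (0 + 1)) with 2 by (simpl; ring).
    apply is_RInt_integrand_0.
  - pose proof (is_RInt_integrand_S k l m r) as H; cbv beta zeta in H.
    rewrite !kPellLucas_plus_Delta_kPell, !kPellLucas_minus_Delta_kPell in H.
    rewrite !Rpow_mult_distr, <- !pow_mult in H.
    rewrite kPellLucas_binet, !pow_add, pow_1.
    replace (2 ^ S m * 2 * _) with
      (2 * (1 + sqrt (1 + INR k)) ^ r
         * (2 ^ S m * (1 + sqrt (1 + INR k)) ^ (l * S m))
       + 2 * (1 - sqrt (1 + INR k)) ^ r
         * (2 ^ S m * (1 - sqrt (1 + INR k)) ^ (l * S m))) by ring.
    exact H.
Qed.

Close Scope R_scope.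

Theorem theorem3p11 (k l n r : nat) (hk : k <> 0%nat) :
  ex_RInt (integrand k l n r) (-1)%R 1%R /\
  INR (kPellLucas k (l * n + r)) =
    (1 / 2 ^ (n + 1) * RInt (integrand k l n r) (-1) 1)%R.
Proof.
  pose proof (is_RInt_integrand k l n r) as H.
  split; [eexists; exact H|].
  rewrite (is_RInt_unique _ _ _ _ H).
  field; apply pow_nonzero; lra.
Qed.
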